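(* Let $P_t$ evolve by the Fokker--Planck equation $\partial_tP_t=-\nabla\cdot(\boldsymbol\nu_tP_t)$ on $\mathbb R^d$ with $\boldsymbol\nu_t=\mu(\boldsymbol F_t-T\nabla\ln P_t)$. Assume that the pseudo canonical distribution does not depend on time, $P^{\rm pcan}_t(\boldsymbol x)=P^{\rm st}(\boldsymbol x)$ for all $t$, and that $P_t(\boldsymbol x)$ decays sufficiently rapidly at infinity. Let $\eta_{P_t}(\boldsymbol x)=P_t(\boldsymbol x)-P^{\rm st}(\boldsymbol x)$ be the difference from the steady-state distribution. Then the Fisher information of time is given by $$(v_{\rm info}(t))^2=-\frac12\,\partial_t\sigma^{\rm ex}_t+O(\eta_{P_t}^3),$$ where $O(\eta_{P_t}^3)$ stands for a term with $O(\eta_{P_t}^3)/(\eta_{P_t}(\boldsymbol x))^2\to0$ in the limit $P_t\to P^{\rm st}$.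
   Context: $\mu>0$, $T>0$ are constants and $\boldsymbol F_t:\mathbb R^d\to\mathbb R^d$ is a force field. The Fisher information of time is $(v_{\rm info}(t))^2=\int d\boldsymbol x\,P_t(\boldsymbol x)(\partial_t\ln P_t(\boldsymbol x))^2$. The excess entropy production rate is $\sigma^{\rm ex}_t=\frac1{\mu T}\lim_{\Delta t\to0}[\mathcal W_2(P_t,P_{t+\Delta t})]^2/(\Delta t)^2$, with $\mathcal W_2$ the $L^2$-Wasserstein distance. Let $\phi_t(\boldsymbol x)\in\mathbb R$ be a potential providing the optimal mean local velocity $\boldsymbol\nu^*_t=\nabla\phi_t$, i.e. $\partial_tP_t=-\nabla\cdot(P_t\nabla\phi_t)$ and $\lim_{\Delta t\to0}[\mathcal W_2(P_t,P_{t+\Delta t})]^2/(\Delta t)^2=\int d\boldsymbol x\,\|\nabla\phi_t(\boldsymbol x)\|^2P_t(\boldsymbol x)$. The pseudo energy $U^*_t$ is defined by $\phi_t(\boldsymbol x)=-\mu U^*_t(\boldsymbol x)-\mu T\ln P_t(\boldsymbol x)$, and the pseudo canonical distribution is $P^{\rm pcan}_t(\boldsymbol x)=\exp[-U^*_t(\boldsymbol x)/T]\big/\int d\boldsymbol x\,\exp[-U^*_t(\boldsymbol x)/T]$. Consequently $\nabla\phi_t=-\mu T\,\nabla\ln(P_t/P^{\rm pcan}_t)$. ''Decays sufficiently rapidly at infinity'' means that boundary terms at infinity in integrations by parts against $P_t$ vanish. Functions are taken regular enough that all displayed expressions are defined and time derivatives may be taken under the integrals; the order of magnitude is counted formally in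 powers of $\eta_{P_t}$ (with $\ln P_t-\ln P^{\rm st}$ and the time derivatives of $\eta_{P_t}$ and $\ln P_t-\ln P^{\rm st}$ counted as first order in $\eta_{P_t}$). *)

(* Defs.v *)
(* MathComp-Analysis: R : realType, points of R^d are row vectors 'rV[R]_d. *)
From HB Require Import structures.
From mathcomp Require Import all_boot all_order all_algebra.
From mathcomp Require Import all_classical all_reals all_analysis.

Set Implicit Arguments.
Unset Strict Implicit.
Unset Printing Implicit Defensive.

Import Order.TTheory GRing.Theory Num.Theory.
Import numFieldNormedType.Exports.

Local Open Scope classical_set_scope.
Local Open Scope ring_scope.

Definition rV_display : measure_display. Proof. exact: default_measure_display. Qed.

(* Borel sets of R^d: the sigma-algebra generated by the coordinates. *)
Section measurable_rV.
Context {R : realType} (d : nat).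

Definition coord (i : 'I_d) (x : 'rV[R]_d) : measurableTypeR R := x ord0 i.

Let set0_rV : g_sigma_preimage coord set0.
Proof. exact: sigma_algebra0. Qed.

Let setC_rV A : g_sigma_preimage coord A -> g_sigma_preimage coord (~` A).
Proof. exact: sigma_algebraC. Qed.

Let bigcup_rV (F : _^nat) : (forall i, g_sigma_preimage coord (F i)) ->
  g_sigma_preimage coord (\bigcup_i (F i)).
Proof. exact: sigma_algebra_bigcup. Qed.

HB.instance Definition _ := @isMeasurable.Build rV_display
  'rV[R]_d (g_sigma_preimage coord) set0_rV setC_rV bigcup_rV.

End measurable_rV.

Section measurable_cons_rV.
Context {R : realType}.

Lemma measurable_coord d (i : 'I_d) : measurable_fun setT (@coord R d i).
Proof.
move=> _ Y mY; rewrite setTI; apply: sub_sigma_algebra => /=.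
rewrite -bigcup_seq/=; exists i => /=; first by rewrite mem_index_enum.
by exists Y => //; rewrite setTI.
Qed.

Lemma measurable_fun_coordP d d1 (T1 : measurableType d1) (f : T1 -> 'rV[R]_d) :
  (forall i, measurable_fun setT (@coord R d i \o f)) ->
  measurable_fun setT f.
Proof.
move=> mf _ A mA; rewrite setTI.
have : g_sigma_preimage (fun i => @coord R d i \o f) `<=` measurable.
  apply: smallest_sub; first exact: sigma_algebra_measurable.
  case: d f mf {A mA} => [|n] f mf; first by rewrite big_ord0.
  rewrite -bigcup_mkord_ord; apply: bigcup_sub => i Ii.
  by move=> B [C mC <-]; exact: mf.
rewrite g_sigma_preimage_comp; apply.
by exists A => //; rewrite setTI.
Qed.

Variable d : nat.

Definition cons_rV (p : measurableTypeR R * 'rV[R]_d) : 'rV[R]_d.+1 :=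
  \row_i oapp (fun j => p.2 ord0 j) p.1 (unlift ord0 i).

Definition uncons_rV (x : 'rV[R]_d.+1) : measurableTypeR R * 'rV[R]_d :=
  (x ord0 ord0, \row_i x ord0 (lift ord0 i)).

Lemma cons_rVK : cancel cons_rV uncons_rV.
Proof.
move=> [a v]; rewrite /uncons_rV /cons_rV mxE unlift_none; congr (_, _).
by apply/rowP => i; rewrite !mxE liftK.
Qed.

Lemma uncons_rVK : cancel uncons_rV cons_rV.
Proof.
move=> x; apply/rowP => i; rewrite /uncons_rV /cons_rV mxE /=.
by case: unliftP => [j ->|->] //=; rewrite mxE.
Qed.

Lemma measurable_uncons_rV : measurable_fun setT uncons_rV.
Proof.
apply: (@measurable_fun_pair _ _ _ _ _ _ (@coord R d.+1 ord0)
  (fun x => \row_i x ord0 (lift ord0 i))); first exact: measurable_coord.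
apply: measurable_fun_coordP => i.
rewrite (_ : _ \o _ = @coord R d.+1 (lift ord0 i));
  first exact: measurable_coord.
by apply/funext => x; rewrite /coord /= mxE.
Qed.

End measurable_cons_rV.

Lemma measurable_cons_rV {R : realType} (d : nat) :
  measurable_fun setT (@cons_rV R d).
Proof.
apply: measurable_fun_coordP => i.
have [j ij|i0] := unliftP ord0 i.
  rewrite (_ : _ \o _ = @coord R d j \o snd); last first.
    by apply/funext => x; rewrite /coord /= mxE ij liftK.
  by apply: measurableT_comp => //; exact: measurable_coord.
rewrite (_ : _ \o _ = fst); first exact: measurable_fst.
by apply/funext => x; rewrite /coord /= mxE i0 unlift_none.
Qed.

Section lebesgue_rV_step.
Context {R : realType} (d : nat).
Variable mu : {sigma_finite_measure set 'rV[R]_d -> \bar R}.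

Definition lebesgue_rVS : set 'rV[R]_d.+1 -> \bar R :=
  pushforward (product_measure1 (@lebesgue_measure R) mu) (@cons_rV R d).

Let mcons : measurable_fun setT (@cons_rV R d) := @measurable_cons_rV R d.

Let lebesgue_rVS0 : lebesgue_rVS set0 = 0%E.
Proof. by rewrite /lebesgue_rVS /pushforward preimage_set0 measure0. Qed.

Let lebesgue_rVS_ge0 A : (0 <= lebesgue_rVS A)%E.
Proof. exact: measure_ge0. Qed.

Let lebesgue_rVS_sigma_additive : semi_sigma_additive lebesgue_rVS.
Proof. exact: measure_semi_sigma_additive. Qed.

HB.instance Definition _ := isMeasure.Build _ _ _ lebesgue_rVS
  lebesgue_rVS0 lebesgue_rVS_ge0 lebesgue_rVS_sigma_additive.

Let sigma_finite_lebesgue_rVS : sigma_finite setT lebesgue_rVS.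
Proof.
have /sigma_finiteP[F [TF ndF Foo]] := sigma_finiteT (@lebesgue_measure R).
have /sigma_finiteP[G [TG ndG Goo]] := sigma_finiteT mu.
have mFG n : measurable (F n `*` G n).
  by apply: measurableX; [exact: (Foo n).1|exact: (Goo n).1].
exists (fun n => @uncons_rV R d @^-1` (F n `*` G n)).
  rewrite -preimage_bigcup (_ : \bigcup_i _ = setT) ?preimage_setT//.
  apply/seteqP; split=> // -[x y] _.
  have /(_ x I) [m _ Fm] : setT `<=` \bigcup_i F i by rewrite TF.
  have /(_ y I) [n _ Gn] : setT `<=` \bigcup_i G i by rewrite TG.
  exists (maxn m n) => //; split => /=.
    by move: x Fm; apply/subsetPset/ndF; rewrite leq_maxl.
  by move: y Gn; apply/subsetPset/ndG; rewrite leq_maxr.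
move=> n; split.
  by rewrite -[X in measurable X]setTI; exact: measurable_uncons_rV.
rewrite /lebesgue_rVS /pushforward -comp_preimage.
rewrite (_ : _ \o _ = id); last by apply/funext => x /=; rewrite cons_rVK.
rewrite preimage_id product_measure1E; [|exact: (Foo n).1|exact: (Goo n).1].
have [mFn Fn] := Foo n; have [mGn Gn] := Goo n.
by rewrite lte_mul_pinfty// ge0_fin_numE.
Qed.

HB.instance Definition _ :=
  Measure_isSigmaFinite.Build _ _ _ lebesgue_rVS sigma_finite_lebesgue_rVS.

End lebesgue_rV_step.

(* Lebesgue measure on R^d: the d-fold product of the one on R. *)
Fixpoint lebesgue_rV (R : realType) (d : nat) :
    {sigma_finite_measure set 'rV[R]_d -> \bar R} :=
  match d return {sigma_finite_measure set 'rV[R]_d -> \bar R} with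
  | 0 => [the {sigma_finite_measure set 'rV[R]_0 -> \bar R} of
            @dirac _ _ (0 : 'rV[R]_0) R]
  | d'.+1 => [the {sigma_finite_measure set 'rV[R]_d'.+1 -> \bar R} of
            @lebesgue_rVS R d' (lebesgue_rV R d')]
  end.

Lemma lebesgue_rV_box (R : realType) (d : nat) (a b : 'rV[R]_d) :
  (forall i, a ord0 i <= b ord0 i) ->
  lebesgue_rV R d [set x | forall i, a ord0 i <= x ord0 i <= b ord0 i] =
  (\prod_(i < d) (b ord0 i - a ord0 i))%:E.
Proof.
elim: d a b => [|d IH] a b ab.
  rewrite big_ord0 /= diracE (_ : _ \in _)//; by rewrite inE => -[].
have mbox n (u v : 'rV[R]_n) :
    measurable [set x : 'rV[R]_n | forall i, u ord0 i <= x ord0 i <= v ord0 i].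
  rewrite (_ : [set _ | _] =
      \bigcap_(i in [set: 'I_n]) (@coord R n i @^-1` `[u ord0 i, v ord0 i])).
    apply: fin_bigcap_measurable => // i _.
    rewrite -[X in measurable X]setTI; apply: (@measurable_coord R n i) => //.
  apply/seteqP; split => x /= h i; last by have := h i I; rewrite /= in_itv.
  by move=> _; rewrite /= in_itv /=; exact: h.
pose a' := \row_i a ord0 (lift ord0 i); pose b' := \row_i b ord0 (lift ord0 i).
rewrite /= /lebesgue_rVS /pushforward.
rewrite (_ : _ @^-1` _ = `[a ord0 ord0, b ord0 ord0]%classic `*`
   [set x : 'rV[R]_d | forall i, a' ord0 i <= x ord0 i <= b' ord0 i]); last first.
  apply/seteqP; split => -[x y] /=.
    move=> h; split; first by have := h ord0; rewrite mxE unlift_none in_itv.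
    by move=> i; have := h (lift ord0 i); rewrite !mxE liftK.
  rewrite in_itv /= => -[hx hy] i; rewrite mxE.
  case: unliftP => [j ->|->] //=; by have := hy j; rewrite !mxE.
rewrite product_measure1E//; last exact: mbox.
rewrite IH; last by move=> i; rewrite !mxE; exact: ab.
rewrite [X in (X * _)%E = _](_ : _ = (b ord0 ord0 - a ord0 ord0)%:E).
  by rewrite big_ord_recl EFinM; under eq_bigr do rewrite !mxE.
apply: etrans (lebesgue_measure_itv _) _ => /=; rewrite lte_fin.
have [//|] := ltP (a ord0 ord0) (b ord0 ord0).
by move=> ba; rewrite (@le_anti _ _ (a ord0 ord0) (b ord0 ord0)) ?subrr ?ab.
Qed.

Notation "'leb" := (lebesgue_rV _ _) (at level 0).

Section vector_calculus.
Context {R : realType} {d : nat}.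
Implicit Types (f : 'rV[R]_d -> R) (G : 'rV[R]_d -> 'rV[R]_d).

Definition dotv (u v : 'rV[R]_d) : R := \sum_k u ord0 k * v ord0 k.

(* Squared Euclidean norm; the library norm on 'rV is the sup norm. *)
Definition sqnorm (u : 'rV[R]_d) : R := dotv u u.

Definition e_ (k : 'I_d) : 'rV[R]_d := delta_mx ord0 k.

Definition grad f (x : 'rV[R]_d) : 'rV[R]_d := \row_k 'D_(e_ k) f x.

Definition divg G (x : 'rV[R]_d) : R :=
  \sum_k 'D_(e_ k) (fun y => G y ord0 k) x.

Definition dt (u : R -> 'rV[R]_d -> R) (t : R) (x : 'rV[R]_d) : R :=
  derive1 (fun s => u s x) t.

Definition continuity_equation (P : R -> 'rV[R]_d -> R) (t : R) G :=
  forall x, (forall k, derivable (fun y => (P t y *: G y) ord0 k) x (e_ k)) /\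
    dt P t x = - divg (fun y => P t y *: G y) x.

End vector_calculus.

Section distributions.
Context {R : realType} {d : nat}.
Implicit Types p q : 'rV[R]_d -> R.

Definition prob_density p :=
  [/\ measurable_fun setT p, forall x, 0 <= p x &
      (\int['leb]_x (p x)%:E = 1)%E].

Definition coupling p q (gamma : probability ('rV[R]_d * 'rV[R]_d)%type R) :=
  forall A : set 'rV[R]_d, measurable A ->
    (gamma (A `*` setT) = \int['leb]_(x in A) (p x)%:E)%E /\
    (gamma (setT `*` A) = \int['leb]_(x in A) (q x)%:E)%E.

Definition wasserstein2 p q : \bar R :=
  sqrte (ereal_inf [set c | exists gamma, coupling p q gamma /\
    (c = \int[gamma]_z (sqnorm (z.1 - z.2)%R)%:E)%E]).

(* The difference quotient whose limit at 0 is the squared Wasserstein speed. *)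
Definition wasserstein_quotient (P : R -> 'rV[R]_d -> R) (t h : R) : \bar R :=
  ((wasserstein2 (P t) (P (t + h)%R)) ^+ 2 * (h ^- 2)%R%:E)%E.

End distributions.

Section thermodynamics.
Context {R : realType} {d : nat}.
Implicit Types (mu T t : R) (P phi : R -> 'rV[R]_d -> R).

(* (v_info(t))^2 *)
Definition fisher_time P t : R :=
  (\int['leb]_x (P t x * dt (fun s y => ln (P s y)) t x ^+ 2))%R.

Definition excess_epr mu T P t : R :=
  (mu * T)^-1 * fine (lim (wasserstein_quotient P t @ 0^')).

Definition mean_local_velocity mu T (F : 'rV[R]_d -> 'rV[R]_d)
    (p : 'rV[R]_d -> R) (x : 'rV[R]_d) : 'rV[R]_d :=
  mu *: (F x - T *: grad (fun y => ln (p y)) x).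

Definition kinetic P phi (t : R) (x : 'rV[R]_d) : R :=
  P t x * sqnorm (grad (phi t) x).

Definition optimal_potential P phi t :=
  continuity_equation P t (grad (phi t)) /\
  wasserstein_quotient P t @ 0^' --> (\int['leb]_x (kinetic P phi t x)%:E)%E.

(* Solves phi_t = - mu U - mu T ln P_t for U. *)
Definition pseudo_energy mu T P phi t (x : 'rV[R]_d) : R :=
  - (phi t x / mu) - T * ln (P t x).

Definition pseudo_canonical mu T P phi t (x : 'rV[R]_d) : R :=
  expR (- pseudo_energy mu T P phi t x / T) /
  (\int['leb]_y expR (- pseudo_energy mu T P phi t y / T))%R.

Record regular_evolution (J : set R) P phi : Prop := {
  regular_density : forall s, J s -> prob_density (P s) ;
  regular_gt0 : forall s x, J s -> 0 < P s x ;
  regular_space : forall s x, J s -> differentiable (P s) x ;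
  regular_time : forall s x, J s -> derivable (fun r => P r x) s 1 ;
  regular_time_space : forall s x, J s -> differentiable (dt P s) x ;
  regular_space_time : forall s x k, J s ->
    derivable (fun r => 'D_(e_ k) (P r) x) s 1 /\
    derive1 (fun r => 'D_(e_ k) (P r) x) s = 'D_(e_ k) (dt P s) x ;
  regular_potential : forall s x, J s -> differentiable (phi s) x }.

Definition derivation_under_integral (u : R -> 'rV[R]_d -> R) t :=
  [/\ \forall s \near t, 'leb.-integrable setT (EFin \o u s),
      'leb.-integrable setT (EFin \o dt u t) &
      is_derive t 1 (fun s => \int['leb]_x u s x)%R (\int['leb]_x dt u t x)%R].

End thermodynamics.

Section decay_and_order.
Context {R : realType} {d : nat}.

(* Growth bounds at infinity, e.g. w = 1 or
   w x = (1 + sqnorm x) ^+ k. *)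
Definition weight (w : 'rV[R]_d -> R) :=
  (forall x, differentiable w x) /\ (forall x, 1 <= w x).

(* Rapid decay at infinity of a density p carried by the velocity field v, at
   the scale of w: integrating f against div (p v) by parts leaves no boundary
   term, for every differentiable f growing at most like w ^ 2 for which both
   volume integrals make sense; and p v^2 integrates w. *)
Definition decays_rapidly (w : 'rV[R]_d -> R) (p : 'rV[R]_d -> R)
    (v : 'rV[R]_d -> 'rV[R]_d) :=
  (\int['leb]_x (w x * (p x * sqnorm (v x)))%R%:E < +oo)%E /\
  forall f : 'rV[R]_d -> R,
    (forall x, differentiable f x) ->
    (exists C, forall x, `|f x| <= C * w x ^+ 2) ->
    'leb.-integrable setT (fun x => (f x * divg (fun y => p y *: v y) x)%:E) ->
    'leb.-integrable setT (fun x => (p x * dotv (grad f x) (v x))%:E) ->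
    (\int['leb]_x (f x * divg (fun y => p y *: v y) x) =
     - \int['leb]_x (p x * dotv (grad f x) (v x)))%R.

(* f_i = O(delta_i) along F, uniformly in x relative to the growth bound w. *)
Definition first_order {I : Type} (F : set_system I) (delta : I -> R)
    (w : 'rV[R]_d -> R) (f : I -> 'rV[R]_d -> R) :=
  exists C : R, \forall i \near F, forall x,
    `|f i x| <= C * `|delta i| * w x.

(* The densities p_i uniformly integrate products of three fields of growth w
   (a gradient of w counting as such a field), so that orders in delta may be
   counted under the integrals. *)
Definition uniform_third_moment {I : Type} (F : set_system I)
    (w : 'rV[R]_d -> R) (p : I -> 'rV[R]_d -> R) :=
  exists C : R, \forall i \near F,
    (\int['leb]_x (p i x * (w x * (w x ^+ 2 + sqnorm (grad w x))))%R%:E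
       <= C%:E)%E.

End decay_and_order.

(* Main.v *)
(* Put k = mu T, v = grad phi_t, u = ln P_t - ln Pst and g = d/dt ln P_t, so that
   div (P_t v) = - P_t g, and, the pseudo canonical distribution being steady,
   v = - k grad u at all times. Differentiating the kinetic energy gives
     d/dt int P |v|^2 = int g P |v|^2 - 2 k int P (grad g . v),
   and integrating by parts against g, int P (grad g . v) = int P g^2, which is
   the Fisher information. The remainder is therefore (2 k)^-1 int g P |v|^2.
   Although u and g are small of order delta, no smallness of v is assumed: it is
   recovered in the mean by integrating by parts against u w, which shows that
   int w P |v|^2 = O(delta^2), so that the remainder is O(delta^3). *)
Require Import Defs.
From HB Require Import structures.
From mathcomp Require Import all_boot all_order all_algebra.
From mathcomp Require Import all_classical all_reals all_analysis.
From mathcomp Require Import measurable_realfun ring lra.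

Set Implicit Arguments.
Unset Strict Implicit.
Unset Printing Implicit Defensive.

Import Order.TTheory GRing.Theory Num.Theory.
Import numFieldNormedType.Exports.

Local Open Scope classical_set_scope.
Local Open Scope ring_scope.

(** * Borel measurability on row vectors, for the sigma-algebra generated by the coordinates *)

Section measurability.
Context {R : realType} {d : nat}.
Implicit Types f : 'rV[R]_d -> R.

(* Every open set is a countable union of balls with rational centres. *)
Lemma open_rV_measurable (U : set 'rV[R]_d) : open U -> measurable U.
Proof.
move=> oU.
pose c (q : 'rV[rat]_d) : 'rV[R]_d := map_mx ratr q.
pose B (p : 'rV[rat]_d * nat) := ball (c p.1) (p.2.+1%:R^-1 : R).
have mB p : measurable (B p).
  (* Balls are taken for the sup norm, so each is a finite intersection of coordinate preimages of
     intervals. *)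
  rewrite (_ : B p = \bigcap_(i in [set: 'I_d])
      (@Defs.coord R d i @^-1` ball (c p.1 ord0 i) (p.2.+1%:R^-1 : R))).
    apply: fin_bigcap_measurable => // i _.
    rewrite -[X in measurable X]setTI; apply: (@measurable_coord R d i) => //.
    exact: measurable_ball.
  apply/seteqP; split => [x [_ xB] i _|x xB]; first exact: (xB ord0 i).
  by split=> // k i; rewrite (ord1 k); exact: (xB i Logic.I).
rewrite (_ : U = \bigcup_(p in [set p | B p `<=` U]) B p); last first.
  apply/seteqP; split => [x Ux|x [p BU /BU//]].
  have /nbhs_ballP[e /= e0 eU] := open_nbhs_nbhs (conj oU Ux).
  (* Both [x] and a generic point [y] of the chosen ball lie within its radius of the centre, hence
     the bound by half of [e]. *)
  have [n] : exists n : nat, n.+1%:R^-1 < e / 2.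
    have e20 : 0 < e / 2 by rewrite divr_gt0.
    exists (Num.truncn (e / 2)^-1).
    by rewrite invf_plt ?posrE// truncnS_gt.
  move=> ne.
  have qP i : {q : rat | x ord0 i < ratr q < x ord0 i + n.+1%:R^-1}.
    apply: cid; have : x ord0 i < x ord0 i + n.+1%:R^-1 by rewrite ltrDl invr_gt0.
    by move=> /rat_in_itvoo[q qx]; exists q; rewrite in_itv /= in qx.
  pose q := \row_i sval (qP i).
  have qx i : `|c q ord0 i - x ord0 i| < n.+1%:R^-1.
    rewrite !mxE; case: (qP i) => r /= /andP[xr rx].
    by rewrite gtr0_norm ?subr_gt0// ltrBlDl.
  have n0 : (0 : R) < n.+1%:R^-1 by rewrite invr_gt0.
  exists (q, n) => /=; last by split=> // k i; rewrite (ord1 k); exact: qx.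
  move=> y [_ By]; apply: eU; split => // k i; rewrite (ord1 k).
  have := By ord0 i; rewrite /ball /= => By'.
  rewrite (_ : _ - _ = - (c q ord0 i - x ord0 i) + (c q ord0 i - y ord0 i));
    last by rewrite opprB addrA subrK.
  by rewrite (le_lt_trans (ler_normD _ _))// normrN (splitr e) ltrD// (lt_trans _ ne).
(* The union is re-indexed over the whole countable type, balls not contained in [U] being replaced
   by [set0]. *)
rewrite (_ : \bigcup_(p in _) _ =
  \bigcup_p (if `[< B p `<=` U >] then B p else set0)).
  apply: countable_bigcupT_measurable => // p; by case: ifP.
apply/seteqP; split => x [p /=].
- by move=> pU Bpx; exists p => //; case: asboolP.
- by case: asboolP => // pU _ Bpx; exists p.
Qed.

Lemma continuous_rV_measurable f : continuous f -> measurable_fun setT f.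
Proof.
move=> cf; apply: (measurability _ (RGenOInfty.measurableE R)).
move=> _ [_ [a ->] <-]; rewrite setTI; apply: open_rV_measurable.
by apply: open_comp => // x _; exact: cf.
Qed.

(** The derivative is the pointwise limit of the difference quotients with steps [1 / (n + 1)], each
    of them measurable by continuity of [f]. *)
Lemma derive_rV_measurable f (v : 'rV[R]_d) :
  continuous f -> (forall x, derivable f x v) -> measurable_fun setT ('D_v f).
Proof.
move=> cf df.
pose h (n : nat) : R := n.+1%:R^-1.
apply: (@measurable_fun_cvg _ _ _ _
  (fun n x => (h n)^-1 * (f (h n *: v + x) - f x))) => [n|x _].
  apply: measurable_funM => //; apply: measurable_funB;
    last exact: continuous_rV_measurable.
  apply: continuous_rV_measurable => x; apply: continuous_comp; last exact: cf.
  have nx : Filter (nbhs x) by exact: nbhs_filter.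
  exact: (cvgD (@cvg_cst _ (h n *: v) _ (nbhs x) nx) (@cvg_id _ (nbhs x))).
have /cvgr_dnbhsP : (r^-1 *: (f (r *: v + x) - f x)) @[r --> 0^'] --> 'D_v f x.
  exact: df.
move=> /(_ h); apply; split; last first.
  exact: cvg_harmonic.
by move=> n; rewrite invr_eq0 pnatr_eq0.
Qed.

Lemma differentiable_rV_measurable f :
  (forall x, differentiable f x) -> measurable_fun setT f.
Proof.
move=> df; apply: continuous_rV_measurable => x.
exact: differentiable_continuous.
Qed.

Lemma grad_measurable f k : (forall x, differentiable f x) ->
  measurable_fun setT (fun x => grad f x ord0 k).
Proof.
move=> df; rewrite (_ : (fun _ => _) = 'D_(e_ k) f); last first.
  by apply/funext => x; rewrite mxE.
apply: derive_rV_measurable => x; last exact: diff_derivable.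
exact: differentiable_continuous.
Qed.

Lemma dotv_measurable (G H : 'rV[R]_d -> 'rV[R]_d) :
  (forall k, measurable_fun setT (fun x => G x ord0 k)) ->
  (forall k, measurable_fun setT (fun x => H x ord0 k)) ->
  measurable_fun setT (fun x => dotv (G x) (H x)).
Proof.
by move=> mG mH; apply: measurable_sum => k; exact: measurable_funM.
Qed.

End measurability.

(** * Integrability of real-valued functions: domination and linearity *)

Section integration.
Context {d : measure_display} {X : measurableType d} {R : realType}.
Variable m : {measure set X -> \bar R}.
Implicit Types f g : X -> R.

Lemma integrable_le f g : measurable_fun setT f -> (forall x, `|f x| <= g x) ->
  m.-integrable setT (EFin \o g) -> m.-integrable setT (EFin \o f).
Proof.
move=> mf fg; apply: le_integrable => //; first exact/measurable_EFinP.
by move=> x _ /=; rewrite lee_fin (le_trans (fg x))// ler_norm.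
Qed.

Lemma integrable_ge0 f : measurable_fun setT f -> (forall x, 0 <= f x) ->
  (\int[m]_x (f x)%:E < +oo)%E -> m.-integrable setT (EFin \o f).
Proof.
move=> mf f0 foo; apply/integrableP; split; first exact/measurable_EFinP.
by under eq_integral do rewrite /= ger0_norm//.
Qed.

Lemma integrable_scale (s : R) f : m.-integrable setT (EFin \o f) ->
  m.-integrable setT (EFin \o (fun x => s * f x)).
Proof. exact: integrableZl. Qed.

Lemma integrable_add f g : m.-integrable setT (EFin \o f) ->
  m.-integrable setT (EFin \o g) ->
  m.-integrable setT (EFin \o (fun x => f x + g x)).
Proof. exact: integrableD. Qed.

Lemma integrable_sub f g : m.-integrable setT (EFin \o f) ->
  m.-integrable setT (EFin \o g) ->
  m.-integrable setT (EFin \o (fun x => f x - g x)).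
Proof. exact: integrableB. Qed.

End integration.

(** * The dot product and a weighted Young inequality *)

Section vectors.
Context {R : realType} {d : nat}.
Implicit Types b c v : 'rV[R]_d.

Lemma dotvDl b c v : dotv (b + c) v = dotv b v + dotv c v.
Proof. by rewrite -big_split; apply: eq_bigr => k _; rewrite mxE mulrDl. Qed.

Lemma dotvZl s b v : dotv (s *: b) v = s * dotv b v.
Proof. by rewrite mulr_sumr; apply: eq_bigr => k _; rewrite mxE mulrA. Qed.

Lemma sqnorm_ge0 v : 0 <= sqnorm v.
Proof. by apply: sumr_ge0 => k _; rewrite -expr2 sqr_ge0. Qed.

(** Young's inequality, coordinate by coordinate: the gap between the two sides is a multiple of
    [(|y| - k a |x|) ^ 2]. The coefficient [(2 * k)^-1] of [sqnorm v] is half of the [k^-1] that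
    stands before the energy to be absorbed. *)
Lemma normr_scale_dotv_le (k a s r : R) b v : 0 < k -> 0 <= a -> 0 <= r ->
  `|s| <= a * r ->
  `|s * dotv b v| <= r * ((2 * k)^-1 * sqnorm v + k * a ^+ 2 / 2 * sqnorm b).
Proof.
move=> k0 a0 r0 sar; rewrite /sqnorm /dotv !mulr_sumr -big_split /= !mulr_sumr.
rewrite (le_trans (ler_norm_sum _ _ _))//; apply: ler_sum => j _.
set x := b ord0 j; set y := v ord0 j.
rewrite -!expr2 !normrM -(real_normK (num_real x)) -(real_normK (num_real y)).
rewrite (@le_trans _ _ (a * r * (`|x| * `|y|)))//.
  by rewrite ler_wpM2r// mulr_ge0.
rewrite -subr_ge0 (_ : _ - _ = r * (2 * k)^-1 * (`|y| - k * a * `|x|) ^+ 2).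
  by rewrite mulr_ge0 ?sqr_ge0// mulr_ge0 ?invr_ge0// mulr_ge0// ltW.
by field; rewrite gt_eqF.
Qed.

End vectors.

(** * Energy estimates at a fixed time, for a velocity [v = - k grad u] *)

Section energy_estimate.
Context {R : realType} {d : nat}.
Local Notation V := 'rV[R]_d.
Variables (k a M : R) (w p u g : V -> R) (v : V -> V).
Hypotheses (k_gt0 : 0 < k) (a_ge0 : 0 <= a) (w_weight : weight w).
Hypotheses (mp : measurable_fun setT p) (p_ge0 : forall x, 0 <= p x).
Hypothesis du : forall x, differentiable u x.
Hypothesis dg : forall x, differentiable g x.
Hypothesis vE : forall x, v x = - k *: grad u x.
Hypothesis divE : forall x, divg (fun y => p y *: v y) x = - (p x * g x).
Hypothesis u_le : forall x, `|u x| <= a * w x.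
Hypothesis g_le : forall x, `|g x| <= a * w x.
Hypothesis moment_le :
  (\int['leb]_x (p x * (w x * (w x ^+ 2 + sqnorm (grad w x))))%R%:E <= M%:E)%E.
Hypothesis decay : decays_rapidly w p v.

Let moment x := p x * (w x * (w x ^+ 2 + sqnorm (grad w x))).
Let energy x := w x * (p x * sqnorm (v x)).

Let dw : forall x, differentiable w x. Proof. by case: w_weight. Qed.
Let w_ge1 : forall x, 1 <= w x. Proof. by case: w_weight. Qed.
Let w_ge0 x : 0 <= w x. Proof. exact: le_trans (w_ge1 x). Qed.
Let mw := differentiable_rV_measurable dw.
Let measurable_u := differentiable_rV_measurable du.
Let mg := differentiable_rV_measurable dg.

Let mv j : measurable_fun setT (fun x => v x ord0 j).
Proof.
under eq_fun do rewrite vE mxE.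
by apply: measurable_funM => //; exact: grad_measurable.
Qed.

Let m_sqnorm_v : measurable_fun setT (fun x => sqnorm (v x)).
Proof. exact: dotv_measurable. Qed.

Let moment_ge0 x : 0 <= moment x.
Proof. by rewrite !mulr_ge0// addr_ge0// ?sqr_ge0// sqnorm_ge0. Qed.

Let moment_int : 'leb.-integrable setT (EFin \o moment).
Proof.
apply: integrable_ge0 => //; last by rewrite (le_lt_trans moment_le)// ltry.
apply: measurable_funM => //; apply: measurable_funM => //.
apply: measurable_funD; first exact: measurable_funX.
by apply: dotv_measurable => j; exact: grad_measurable.
Qed.

Let moment_Rint_le : \int['leb]_x moment x <= M.
Proof.
have [_ foo] := integrableP _ _ _ moment_int.
rewrite /Rintegral -[leRHS]/(fine M%:E) fine_le//.
exact: integrable_fin_num.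
Qed.

Let energy_int : 'leb.-integrable setT (EFin \o energy).
Proof.
apply: integrable_ge0; last by case: decay.
  by do 2!apply: measurable_funM => //.
by move=> x; rewrite !mulr_ge0// sqnorm_ge0.
Qed.

Let pw2_le_moment x : p x * w x ^+ 2 <= moment x.
Proof.
rewrite ler_wpM2l// (@le_trans _ _ (w x * w x ^+ 2))//.
  by rewrite ler_peMl// ?sqr_ge0.
by rewrite ler_wpM2l// lerDl sqnorm_ge0.
Qed.

Let pw3_le_moment x : p x * w x ^+ 3 <= moment x.
Proof. by rewrite ler_wpM2l// exprS ler_wpM2l// lerDl sqnorm_ge0. Qed.

(** Up to the factor [(2 * k)^-1], the integrand of the final remainder. *)
Let dissipation x := g x * (p x * sqnorm (v x)).

Let dissipation_le x : `|dissipation x| <= a * energy x.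
Proof.
rewrite /dissipation /energy normrM (@ger0_norm _ (p x * _)) ?mulr_ge0 ?sqnorm_ge0//.
by rewrite [leRHS]mulrA ler_wpM2r// mulr_ge0 ?sqnorm_ge0.
Qed.

Let dissipation_int : 'leb.-integrable setT (EFin \o dissipation).
Proof.
apply: (@integrable_le _ _ _ _ _ (fun x => a * energy x)) => //.
  by do 2!apply: measurable_funM => //.
exact: integrable_scale.
Qed.

(* Testing the continuity equation against u w gives
   k^-1 * int w p |v|^2 = int p u (grad w . v) - int u w p g; AM-GM absorbs half
   of the left-hand side, the rest being quadratic in a. *)
Lemma weighted_energy_le :
  \int['leb]_x energy x <= k * (k + 2) * a ^+ 2 * M.
Proof.
have df x : differentiable (u * w) x by exact: differentiableM.
have gradE x : grad (u * w) x = u x *: grad w x + w x *: grad u x.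
  apply/rowP => j; rewrite !mxE deriveM; [by []|exact: diff_derivable..].
pose A x := p x * (u x * dotv (grad w x) (v x)).
pose B x := u x * w x * divg (fun y => p y *: v y) x.
have A_le x : `|A x| <= (2 * k)^-1 * energy x + k * a ^+ 2 / 2 * moment x.
  rewrite /A normrM ger0_norm//.
  have := ler_wpM2l (p_ge0 x)
    (normr_scale_dotv_le (grad w x) (v x) k_gt0 a_ge0 (w_ge0 x) (u_le x)).
  move=> /le_trans; apply.
  rewrite -subr_ge0 /energy /moment.
  rewrite (_ : _ - _ = k * a ^+ 2 / 2 * (p x * (w x * w x ^+ 2))); last by ring.
  by rewrite !mulr_ge0 ?sqr_ge0 ?invr_ge0// ltW.
have mA : measurable_fun setT A.
  apply: measurable_funM => //; apply: measurable_funM => //.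
  by apply: dotv_measurable => // j; exact: grad_measurable.
have A_int : 'leb.-integrable setT (EFin \o A).
  apply: (integrable_le mA A_le).
  by apply: integrable_add; exact: integrable_scale.
have B_le x : `|B x| <= a ^+ 2 * moment x.
  rewrite /B divE mulrN normrN !normrM (ger0_norm (p_ge0 x)) (ger0_norm (w_ge0 x)).
  rewrite (@le_trans _ _ (a * w x * w x * (p x * (a * w x))))//.
    by rewrite ler_pM ?mulr_ge0// ?ler_wpM2r// ?ler_wpM2l.
  rewrite (_ : _ * _ = a ^+ 2 * (p x * w x ^+ 3)); last by ring.
  by rewrite ler_wpM2l// sqr_ge0.
have mB : measurable_fun setT B.
  rewrite /B; under eq_fun do rewrite divE mulrN.
  by apply: measurableT_comp => //; do 2!apply: measurable_funM => //.
have B_int : 'leb.-integrable setT (EFin \o B).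
  by apply: (integrable_le mB B_le); exact: integrable_scale.
have dotE x : p x * dotv (grad (u * w) x) (v x) = A x - k^-1 * energy x.
  rewrite gradE dotvDl !dotvZl /A /energy mulrDr; congr (_ + _).
  (* Reading [v = - k grad u] backwards turns the term in [grad u] into the energy. *)
  have -> : grad u x = - k^-1 *: v x.
    by rewrite vE scalerA mulrNN mulVf ?scale1r// gt_eqF.
  by rewrite dotvZl /sqnorm; ring.
have kE_int := integrable_scale k^-1 energy_int.
have parts : \int['leb]_x B x = - \int['leb]_x (A x - k^-1 * energy x).
  rewrite -(eq_Rintegral _ (fun x _ => dotE x)).
  case: decay => _; apply; first exact: df.
  (* The test function [u w] grows like [a w ^ 2], which is exactly the growth that [decays_rapidly]
     admits. *)
  - exists a => x; rewrite normrM (ger0_norm (w_ge0 x)) expr2 mulrA.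
    by rewrite ler_wpM2r.
  - exact: B_int.
  - under eq_fun do rewrite dotE.
    exact: integrable_sub.
rewrite RintegralB// in parts.
have A_Rle : \int['leb]_x A x <=
    (2 * k)^-1 * \int['leb]_x energy x + k * a ^+ 2 / 2 * \int['leb]_x moment x.
  rewrite -!RintegralZl// -RintegralD//; try exact: integrable_scale.
  apply: le_Rintegral => //.
    by apply: integrable_add; exact: integrable_scale.
  by move=> x _; rewrite (le_trans (ler_norm _)).
have B_Rle : `|\int['leb]_x B x| <= a ^+ 2 * \int['leb]_x moment x.
  apply: le_trans (le_normr_Rintegral measurableT B_int) _.
  rewrite -RintegralZl//; apply: le_Rintegral => //; first exact: integrable_norm.
  exact: integrable_scale.
set E := \int['leb]_x energy x in parts A_Rle *.
have := moment_Rint_le; set N := \int['leb]_x moment x in A_Rle B_Rle * => N_le.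
move: parts; rewrite RintegralZl// -/E => parts.
(* The share [k / 2] comes from Young's inequality in [A], the share [1] from [B]; multiplying by
   [2 * k] afterwards gives [k * (k + 2)]. *)
have : (2 * k)^-1 * E <= (k / 2 + 1) * a ^+ 2 * M.
  rewrite (@le_trans _ _ ((k / 2 + 1) * a ^+ 2 * N))//; last first.
    by rewrite ler_wpM2l// mulr_ge0 ?sqr_ge0// addr_ge0// divr_ge0// ltW.
  have := le_trans (ler_norm _) B_Rle.
  have -> : (2 * k)^-1 * E = k^-1 * E - (2 * k)^-1 * E.
    by field; rewrite gt_eqF.
  move: A_Rle parts; set Ai := \int['leb]_x A x; lra.
rewrite -(@ler_pM2l _ (2 * k)) ?mulr_gt0// mulrA divff ?mul1r; last first.
  by rewrite gt_eqF// mulr_gt0.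
by move=> /le_trans; apply; rewrite le_eqVlt; apply/orP; left; apply/eqP; field.
Qed.

(** One factor [a] comes from [|g| <= a w], two more from the weighted energy; the weight in
    [energy] is there to absorb the growth of [g]. *)
Lemma dissipation_Rintegral_le :
  `|\int['leb]_x dissipation x| <= k * (k + 2) * a ^+ 3 * M.
Proof.
apply: le_trans (le_normr_Rintegral measurableT dissipation_int) _.
apply: (@le_trans _ _ (\int['leb]_x (a * energy x))).
  apply: le_Rintegral => //; first exact: integrable_norm.
  exact: integrable_scale.
rewrite RintegralZl// (_ : _ * M = a * (k * (k + 2) * a ^+ 2 * M)); last by ring.
by rewrite ler_wpM2l// weighted_energy_le.
Qed.

(** Here [h] stands for the time derivative of the kinetic energy density. Integrating by parts
    against [g] and using [divE] turns the integral of [p (grad g . v)] into that of [p g ^ 2]. *)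
Lemma Rintegral_production (h : V -> R) :
  (forall x, h x = dissipation x - 2 * k * (p x * dotv (grad g x) (v x))) ->
  'leb.-integrable setT (EFin \o h) ->
  \int['leb]_x h x =
  \int['leb]_x dissipation x - 2 * k * \int['leb]_x (p x * g x ^+ 2).
Proof.
move=> hE h_int.
have k2 : 2 * k != 0 by rewrite gt_eqF// mulr_gt0.
pose D x := p x * dotv (grad g x) (v x).
(* The integrability of [D], required by the integration by parts, is deduced from that of [h] and
   [dissipation]. *)
have DE x : D x = (2 * k)^-1 * (dissipation x - h x).
  by rewrite hE /D opprB addrC subrK mulKf.
have D_int : 'leb.-integrable setT (EFin \o D).
  rewrite (_ : D = fun x => (2 * k)^-1 * (dissipation x - h x)).
    by apply: integrable_scale; exact: integrable_sub.
  exact/funext.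
pose G x := g x * divg (fun y => p y *: v y) x.
have GE x : G x = - (p x * g x ^+ 2) by rewrite /G divE; ring.
have mpg : measurable_fun setT (fun x => p x * g x ^+ 2).
  by apply: measurable_funM => //; exact: measurable_funX.
have pg_int : 'leb.-integrable setT (EFin \o (fun x => p x * g x ^+ 2)).
  apply: (@integrable_le _ _ _ _ _ (fun x => a ^+ 2 * moment x)) => //; last first.
    exact: integrable_scale.
  move=> x; rewrite ger0_norm; last by rewrite mulr_ge0// sqr_ge0.
  rewrite (@le_trans _ _ (a ^+ 2 * (p x * w x ^+ 2)))//; last first.
    by rewrite ler_wpM2l// sqr_ge0.
  rewrite [leRHS]mulrCA ler_wpM2l// -exprMn.
  by rewrite -[leLHS](real_normK (num_real _)) ler_pXn2r// nnegrE mulr_ge0.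
have pgD : \int['leb]_x (p x * g x ^+ 2) = \int['leb]_x D x.
  apply: oppr_inj; case: decay => _ /(_ g dg) <-.
  - rewrite -mulN1r -RintegralZl//; apply: eq_Rintegral => x _.
    by rewrite -/(G x) GE mulN1r.
  (* Since [1 <= w], growth like [w] is also growth like [w ^ 2]. *)
  - exists a => x; rewrite (le_trans (g_le x))// ler_wpM2l//.
    by rewrite expr2 ler_peMl.
  - rewrite (_ : (fun _ => _) = EFin \o (fun x => -1 * (p x * g x ^+ 2))).
      exact: integrable_scale.
    by apply/funext => x; rewrite -/(G x) GE /= mulN1r.
  - exact: D_int.
rewrite pgD -RintegralZl// -RintegralB//; last exact: integrable_scale.
exact: eq_Rintegral.
Qed.

End energy_estimate.

(** * Derivatives of logarithms and inverses *)

Section derivatives.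
Context {R : realType} {V : normedModType R}.
Implicit Types f : V -> R.

Lemma differentiable_ln_comp f x : differentiable f x -> 0 < f x ->
  differentiable (fun y => ln (f y)) x.
Proof.
move=> df f0; apply: (@differentiable_comp _ _ _ _ f (@ln R)) => //.
by apply/derivable1_diffP; apply: ex_derive; exact: is_derive1_ln.
Qed.

Lemma derive_ln_comp f x v : differentiable f x -> 0 < f x ->
  'D_v (fun y => ln (f y)) x = (f x)^-1 * 'D_v f x.
Proof.
move=> df f0.
have dl : differentiable (@ln R) (f x).
  by apply/derivable1_diffP; apply: ex_derive; exact: is_derive1_ln.
rewrite !deriveE//; last exact: differentiable_ln_comp.
rewrite (_ : (fun y => ln (f y)) = @ln R \o f)// diff_comp//= diff1E//=.
by rewrite derive1E (derive_val (is_derive := is_derive1_ln f0)) mulrC.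
Qed.

Lemma is_derive_inv f x v (df : R) : f x != 0 -> is_derive x v f df ->
  is_derive x v (fun y => (f y)^-1) (- (f x) ^- 2 * df).
Proof.
by move=> f0 [dfx <-]; apply: DeriveDef; [exact: derivableV|rewrite deriveV].
Qed.

End derivatives.

(** * The potential under a steady pseudo canonical distribution, and the derivative of the excess
    rate *)

Section optimal_transport.
Context {R : realType} {d : nat}.
Local Notation V := 'rV[R]_d.
Variables (mu T : R) (Pst : V -> R) (J : set R) (t : R).
Variables (P phi : R -> V -> R).
Hypotheses (mu_gt0 : 0 < mu) (T_gt0 : 0 < T) (Pst_density : prob_density Pst).
Hypotheses (J_open : open J) (Jt : J t).
Hypothesis P_regular : regular_evolution J P phi.
Hypothesis phi_optimal : forall s, J s -> optimal_potential P phi s.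
Hypothesis pcan_steady : forall s x, J s -> pseudo_canonical mu T P phi s x = Pst x.
Hypothesis exchange : derivation_under_integral (kinetic P phi) t.

Let k := mu * T.
Let k_gt0 : 0 < k. Proof. exact: mulr_gt0. Qed.
Let g x := (P t x)^-1 * dt P t x.

(** Taking logarithms in the formula for the pseudo canonical distribution gives this with
    [c = k ln Z]. The constant varies with [s], but disappears from spatial gradients. *)
Lemma pseudo_canonical_potential s : J s ->
  exists c, forall x, phi s x = c - k * (ln (P s x) - ln (Pst x)).
Proof.
move=> Js.
set Z := \int['leb]_y expR (- pseudo_energy mu T P phi s y / T).
have PstE x : Pst x = expR (- pseudo_energy mu T P phi s x / T) / Z.
  by rewrite -(pcan_steady x Js).
(* If [Z] were [0], which is also the value of [Rintegral] for an infinite integral, division by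
   zero would make [Pst] vanish everywhere, against its total mass [1]. *)
have Z_gt0 : 0 < Z.
  rewrite lt_neqAle Rintegral_ge0 ?andbT; last by move=> *; exact: expR_ge0.
  apply/eqP => Z0; case: Pst_density => _ _.
  under eq_integral do rewrite PstE -Z0 invr0 mulr0.
  by rewrite integral0 => /eqP; rewrite eqe eq_sym oner_eq0.
exists (k * ln Z) => x.
rewrite PstE lnM ?posrE ?expR_gt0 ?invr_gt0// expRK lnV ?posrE// /pseudo_energy /k.
by field; rewrite !gt_eqF.
Qed.

Let logratio x := ln (P t x) - ln (Pst x).

Let logratioE : exists c, logratio = (fun x => k^-1 * (c - phi t x)).
Proof.
have [c phiE] := pseudo_canonical_potential Jt; exists c; apply/funext => x.
by rewrite phiE /logratio; field; rewrite gt_eqF.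
Qed.

(** Smoothness is inherited from [phi t], of which the log-ratio is an affine function. *)
Lemma differentiable_logratio x : differentiable logratio x.
Proof.
have [c ->] := logratioE.
apply: differentiableZ; apply: differentiableB => //.
exact: (regular_potential P_regular).
Qed.

Lemma grad_potential x : grad (phi t) x = - k *: grad logratio x.
Proof.
have [c phiE] := pseudo_canonical_potential Jt.
apply/rowP => j; rewrite !mxE.
have -> : phi t = cst c - k *: logratio by apply/funext => y; rewrite phiE.
have dl := @diff_derivable _ _ _ _ _ (e_ j) (differentiable_logratio x).
rewrite deriveB; [|exact: derivable_cst|exact: derivableZ].
by rewrite derive_cst sub0r deriveZ// mulNr.
Qed.

(** Comparing the times [s] and [t] eliminates [Pst]. In the resulting formula [s] enters only
    through [P s], whose time regularity is available, so the gradient of the potential can be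
    differentiated in time. *)
Lemma derive_potential s x j : J s ->
  'D_(e_ j) (phi s) x = 'D_(e_ j) (phi t) x -
    k * ((P s x)^-1 * 'D_(e_ j) (P s) x - (P t x)^-1 * 'D_(e_ j) (P t) x).
Proof.
move=> Js.
have [c phiE] := pseudo_canonical_potential Js.
have [c0 phi0E] := pseudo_canonical_potential Jt.
have dP r : J r -> differentiable (P r) x.
  by move=> Jr; exact: (Defs.regular_space P_regular).
have P0 r : J r -> 0 < P r x by move=> Jr; exact: (regular_gt0 P_regular).
have dln r (Jr : J r) := differentiable_ln_comp (dP r Jr) (P0 r Jr).
pose L r := fun y => ln (P r y).
have dL r (Jr : J r) : derivable (L r) x (e_ j) by apply: diff_derivable; exact: dln.
have -> : phi s = phi t - k *: (L s - L t) + cst (c - c0).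
  apply/funext => y; rewrite -[RHS]/(phi t y - k * (L s y - L t y) + (c - c0)).
  by rewrite phiE phi0E /L; ring.
have dphi : derivable (phi t) x (e_ j).
  by apply: diff_derivable; exact: (regular_potential P_regular).
have dLL : derivable (L s - L t) x (e_ j) by apply: derivableB; exact: dL.
have dkLL : derivable (k *: (L s - L t)) x (e_ j) by exact: derivableZ.
rewrite deriveD; [|exact: derivableB|exact: derivable_cst].
rewrite derive_cst addr0 deriveB; [|exact: dphi|exact: dkLL].
rewrite deriveZ; last exact: dLL.
rewrite deriveB; [|exact: dL..].
by rewrite !derive_ln_comp//; do ?[exact: P0|exact: dP].
Qed.

Lemma differentiable_dt_ln x : differentiable g x.
Proof.
apply: differentiableM; last exact: (regular_time_space P_regular).
apply: differentiableV; first exact: (Defs.regular_space P_regular).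
by rewrite gt_eqF//; exact: (regular_gt0 P_regular).
Qed.

Let is_derive_P x : is_derive t 1 (P^~ x) (dt P t x).
Proof.
apply: DeriveDef; first exact: (regular_time P_regular).
by rewrite /dt derive1E.
Qed.

(** The shift [c] serves two uses: [0] for the Fisher information and [ln (Pst x)] for the
    first-order bound. *)
Lemma dt_ln x (c : R) : dt (fun s y => ln (P s y) - c) t x = g x.
Proof.
rewrite /dt derive1E.
have dP : differentiable (P^~ x) t.
  by apply/derivable1_diffP; exact: (regular_time P_regular).
have P0 : 0 < P t x by exact: (regular_gt0 P_regular).
rewrite (_ : (fun _ => _) = (fun s => ln (P s x)) - cst c)//.
rewrite deriveB//; last exact/diff_derivable/differentiable_ln_comp.
by rewrite derive_cst subr0 derive_ln_comp// /g /dt derive1E.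
Qed.

(** Product rule: the first term comes from [dt P = P g], the second from the fact that the time
    derivative of [grad phi] is [- k grad g]. *)
Lemma is_derive_kinetic x : is_derive t 1 (fun s => kinetic P phi s x)
  (g x * (P t x * sqnorm (grad (phi t) x)) -
   2 * k * (P t x * dotv (grad g x) (grad (phi t) x))).
Proof.
have P0 : 0 < P t x by exact: (regular_gt0 P_regular).
pose q j s := 'D_(e_ j) (phi t) x -
    k * ((P s x)^-1 * 'D_(e_ j) (P s) x - (P t x)^-1 * 'D_(e_ j) (P t) x).
have dq j : is_derive t 1 (q j) (- k * grad g x ord0 j).
  (* Exchange of the time derivative with the spatial one. *)
  have [d1 d2] := regular_space_time P_regular x j Jt.
  have := derivableP d1; rewrite -derive1E d2 => dS.
  have P_neq0 : P t x != 0 by rewrite gt_eqF.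
  have dV := is_derive_inv P_neq0 (is_derive_P x).
  have gE : grad g x ord0 j = (P t x)^-1 * 'D_(e_ j) (dt P t) x
      - (P t x)^- 2 * 'D_(e_ j) (P t) x * dt P t x.
    have dPx := is_derive_inv P_neq0 (derivableP
      (@diff_derivable _ _ _ _ _ (e_ j) (Defs.regular_space P_regular x Jt))).
    have ddtP := derivableP
      (@diff_derivable _ _ _ _ _ (e_ j) (regular_time_space P_regular x Jt)).
    have [_ gE] := is_deriveM dPx ddtP.
    by rewrite mxE [LHS]gE /GRing.scale /=; ring.
  rewrite gE.
  have h1 := is_deriveB (is_deriveM dV dS)
    (is_derive_cst ((P t x)^-1 * 'D_(e_ j) (P t) x) t 1).
  have h2 := is_deriveB (is_derive_cst ('D_(e_ j) (phi t) x) t 1)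
    (@is_deriveZ _ _ _ _ k _ _ _ h1).
  apply: (is_derive_eq h2).
  rewrite /GRing.scale /=; ring.
have dsum : is_derive t 1 (fun s => \sum_j (q j s * q j s))
    (\sum_j (2 * q j t * (- k * grad g x ord0 j))).
  rewrite (_ : (fun _ => _) = \sum_j (q j * q j)); last first.
    by apply/funext => s; rewrite fct_sumE.
  apply: (is_derive_eq (is_derive_sum (fun j => is_deriveM (dq j) (dq j)))).
  by apply: eq_bigr => j _; rewrite -scalerDl /GRing.scale /=; ring.
have dprod := is_deriveM (is_derive_P x) dsum.
(* The formula [q] agrees with the gradient only for [s] in [J]; as [J] is open, this holds near
   [t], which suffices for the derivative. *)
have near_kin : \forall s \near t,
    P s x * \sum_j (q j s * q j s) = kinetic P phi s x.
  near=> s; rewrite /kinetic /sqnorm /dotv; congr (_ * _).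
  have Js : J s by near: s; exact: open_nbhs_nbhs.
  by apply: eq_bigr => j _; rewrite mxE derive_potential.
have qE j : q j t = grad (phi t) x ord0 j by rewrite mxE /q subrr mulr0 subr0.
apply: (is_derive_eq (near_eq_is_derive near_kin dprod)).
rewrite /sqnorm /dotv /GRing.scale /= addrC; congr (_ + _).
  under eq_bigr do rewrite qE.
  by rewrite /g; field; rewrite gt_eqF.
rewrite [in RHS]mulrCA -[RHS]mulrN; congr (_ * _); rewrite mulr_sumr -sumrN.
by apply: eq_bigr => j _; rewrite qE; ring.
Unshelve. all: by end_near. Qed.

Lemma dt_kinetic x : dt (kinetic P phi) t x =
  g x * (P t x * sqnorm (grad (phi t) x)) -
  2 * k * (P t x * dotv (grad g x) (grad (phi t) x)).
Proof. by rewrite /dt derive1E; have [_ ->] := is_derive_kinetic x. Qed.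

Lemma excess_eprE s : J s ->
  excess_epr mu T P s = k^-1 * \int['leb]_x kinetic P phi s x.
Proof.
move=> Js; rewrite /excess_epr /Rintegral; congr (_ * fine _).
by apply: cvg_lim; [exact: ereal_hausdorff|exact: (phi_optimal Js).2].
Qed.

Lemma is_derive_excess_epr : is_derive t 1 (excess_epr mu T P)
  (k^-1 * \int['leb]_x dt (kinetic P phi) t x).
Proof.
have [_ _ dint] := exchange.
have nearE : \forall s \near t,
    k^-1 * \int['leb]_x kinetic P phi s x = excess_epr mu T P s.
  near=> s; rewrite excess_eprE//; near: s; exact: open_nbhs_nbhs.
exact: (near_eq_is_derive nearE (@is_deriveZ _ _ _ _ k^-1 _ _ _ dint)).
Unshelve. all: by end_near. Qed.

Variables (a M : R) (w : V -> R).
Hypotheses (a_ge0 : 0 <= a) (w_weight : weight w).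
Hypothesis P_decay : decays_rapidly w (P t) (grad (phi t)).
Hypothesis moment_le : (\int['leb]_x
  (P t x * (w x * (w x ^+ 2 + sqnorm (grad w x))))%R%:E <= M%:E)%E.
Hypothesis log_le : forall x, `|ln (P t x) - ln (Pst x)| <= a * w x.
Hypothesis dt_log_le : forall x,
  `|dt (fun s y => ln (P s y) - ln (Pst y)) t x| <= a * w x.

(** A non-asymptotic bound, with explicit dependence on the size [a] and the moment [M]; it can then
    be applied uniformly along a filter. *)
Lemma fisher_time_remainder_le :
  `|fisher_time P t + 2^-1 * derive1 (excess_epr mu T P) t| <=
  (k + 2) / 2 * a ^+ 3 * M.
Proof.
have [mP P_ge0 _] := regular_density P_regular Jt.
have P_gt0 x : 0 < P t x by exact: (regular_gt0 P_regular).
have divE x : divg (fun y => P t y *: grad (phi t) y) x = - (P t x * g x).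
  rewrite /g mulVKf ?gt_eqF//.
  by have [_ ->] := (phi_optimal Jt).1 x; rewrite opprK.
have g_le x : `|g x| <= a * w x.
  by rewrite -(dt_ln x (ln (Pst x))); exact: dt_log_le.
have fisherE : fisher_time P t = \int['leb]_x (P t x * g x ^+ 2).
  apply: eq_Rintegral => x _; rewrite -(dt_ln x 0); congr (_ * dt _ t x ^+ 2).
  by apply/funext => s; apply/funext => y; rewrite subr0.
have [_ dk_int _] := exchange.
have prodE := Rintegral_production k_gt0 a_ge0 w_weight mP P_ge0
  differentiable_logratio differentiable_dt_ln grad_potential divE g_le
  moment_le P_decay dt_kinetic dk_int.
have rem_le := dissipation_Rintegral_le k_gt0 a_ge0 w_weight mP P_ge0
  differentiable_logratio differentiable_dt_ln grad_potential divE log_le g_le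
  moment_le P_decay.
rewrite derive1E; have [_ ->] := is_derive_excess_epr.
rewrite prodE fisherE.
set D := \int['leb]_x _ in rem_le *; set E := \int['leb]_x _.
(* The Fisher information cancels and only the dissipation survives; dividing [k * (k + 2)] by
   [2 * k] gives the constant [(k + 2) / 2]. *)
rewrite (_ : _ + _ = (2 * k)^-1 * D); last by field; rewrite gt_eqF.
have k2_gt0 : 0 < 2 * k by rewrite mulr_gt0.
rewrite normrM gtr0_norm ?invr_gt0// ler_pdivrMl// (le_trans rem_le)//.
by rewrite le_eqVlt; apply/orP; left; apply/eqP; field.
Qed.

End optimal_transport.

(** * Counting orders along the filter *)

Theorem proposition16 (R : realType) (d : nat) (mu T : R)
    (mu_gt0 : 0 < mu) (T_gt0 : 0 < T)
    (Pst : 'rV[R]_d -> R) (Pst_density : prob_density Pst)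
    (I : Type) (lim_st : filter_on I)
    (J : set R) (J_open : open J) (t : R) (Jt : J t)
    (F : I -> R -> 'rV[R]_d -> 'rV[R]_d)
    (P phi : I -> R -> 'rV[R]_d -> R)
    (P_regular : forall i, regular_evolution J (P i) (phi i))
    (fokker_planck : forall i s, J s ->
      continuity_equation (P i) s (mean_local_velocity mu T (F i s) (P i s)))
    (phi_optimal : forall i s, J s -> optimal_potential (P i) (phi i) s)
    (pcan_steady : forall i s x, J s ->
      pseudo_canonical mu T (P i) (phi i) s x = Pst x)
    (exchange : forall i, derivation_under_integral (kinetic (P i) (phi i)) t)
    (w : 'rV[R]_d -> R) (w_weight : weight w)
    (P_decay : forall i, decays_rapidly w (P i t) (grad (phi i t)))
    (P_moment : uniform_third_moment lim_st w (fun i => P i t))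
    (delta : I -> R) (delta_cvg0 : delta i @[i --> lim_st] --> 0)
    (log_order : first_order lim_st delta w
      (fun i x => ln (P i t x) - ln (Pst x)))
    (dt_log_order : first_order lim_st delta w
      (fun i => dt (fun s x => ln (P i s x) - ln (Pst x)) t)) :
  let eta := fun i x => P i t x - Pst x in
  exists rem : I -> R,
    [/\ forall i, derivable (excess_epr mu T (P i)) t 1 /\
          fisher_time (P i) t
          = - 2^-1 * derive1 (excess_epr mu T (P i)) t + rem i,
        rem =O_lim_st (fun i => delta i ^+ 3) &
        forall x, delta =O_lim_st (eta ^~ x) ->
          rem =O_lim_st (fun i => eta i x ^+ 3) /\
          rem i / eta i x ^+ 2 @[i --> lim_st] --> 0].
Proof.
move=> eta.
pose rem i := fisher_time (P i) t + 2^-1 * derive1 (excess_epr mu T (P i)) t.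
have [C1 le1] := log_order; have [C2 le2] := dt_log_order.
have [M le3] := P_moment.
(* One constant for both first-order bounds, so that the estimate applies with [a = C * |delta i|];
   absolute values are taken because [C1] and [C2] have no prescribed sign. *)
pose C := Num.max `|C1| `|C2|.
have C_ge0 : 0 <= C by rewrite le_max normr_ge0.
(* The added [1] makes the constant strictly positive, as [eqO_exP] demands. *)
have K_gt0 : 0 < (mu * T + 2) / 2 * C ^+ 3 * `|M| + 1.
  rewrite ltr_wpDl// !mulr_ge0 ?exprn_ge0// ?invr_ge0//.
  by rewrite addr_ge0// mulr_ge0// ltW.
set K := _ + 1 in K_gt0.
have rem_le : \forall i \near lim_st, `|rem i| <= K * `|delta i ^+ 3|.
  near=> i.
  have mono (f e : R) (x : 'rV[R]_d) : `|e| <= C ->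
      `|f| <= e * `|delta i| * w x -> `|f| <= C * `|delta i| * w x.
    move=> eC /le_trans; apply.
    have w0 : 0 <= w x by apply: le_trans (w_weight.2 x).
    by rewrite ler_wpM2r// ler_wpM2r// (le_trans (ler_norm e)).
  have a_ge0 : 0 <= C * `|delta i| by rewrite mulr_ge0.
  have := fisher_time_remainder_le mu_gt0 T_gt0 Pst_density J_open Jt
    (P_regular i) (phi_optimal i) (pcan_steady i) (exchange i) a_ge0 w_weight
    (P_decay i).
  move=> /(_ M); rewrite -/(rem i).
  have h1 : forall x, `|ln (P i t x) - ln (Pst x)| <= C * `|delta i| * w x.
    move=> x; apply: (@mono _ C1); first by rewrite le_max lexx.
    by move: x; near: i.
  have h2 : forall x, `|dt (fun s y => ln (P i s y) - ln (Pst y)) t x| <=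
      C * `|delta i| * w x.
    move=> x; apply: (@mono _ C2); first by rewrite le_max lexx orbT.
    by move: x; near: i.
  have h3 : (\int['leb]_x (P i t x * (w x * (w x ^+ 2 + sqnorm (grad w x))))%R%:E
      <= M%:E)%E by near: i.
  move=> /(_ h3 h1 h2) /le_trans; apply.
  rewrite exprMn -normrX mulrA -[leLHS]mulrA [`|_| * M]mulrC mulrA.
  rewrite ler_wpM2r// /K (@le_trans _ _ ((mu * T + 2) / 2 * C ^+ 3 * `|M|))//.
    rewrite ler_wpM2l// ?ler_norm// !mulr_ge0 ?exprn_ge0// ?invr_ge0//.
    by rewrite addr_ge0// mulr_ge0// ltW.
  by rewrite lerDl.
exists rem; split.
- move=> i; have [dsigma _] :=
    is_derive_excess_epr mu T J_open Jt (phi_optimal i) (exchange i).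
  by split; [exact: dsigma|rewrite /rem; ring].
- by apply/eqO_exP; exists K.
move=> x /eqO_exP[N N_gt0 delta_le].
split.
  apply/eqO_exP; exists (K * N ^+ 3); first by rewrite mulr_gt0// exprn_gt0.
  near=> i; apply: (@le_trans _ _ (K * `|delta i ^+ 3|)); first by near: i.
  rewrite -mulrA ler_wpM2l ?(ltW K_gt0)// !normrX -exprMn.
  rewrite ler_pXn2r// ?nnegrE// ?mulr_ge0// ?(ltW N_gt0)//.
  by near: i.
(* Of the three factors [delta], two are traded for [N * |eta|] and cancel the denominator; the
   third remains, so the quotient is at most [K * N ^ 2 * |delta|], which tends to [0]. *)
have KN_gt0 : 0 < K * N ^+ 2 by rewrite mulr_gt0// exprn_gt0.
apply/cvgr0Pnorm_lt => e e_gt0.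
have eKN : 0 < e / (K * N ^+ 2) by rewrite divr_gt0.
have delta_lt := (cvgr0Pnorm_lt _).1 delta_cvg0 _ eKN.
near=> i.
apply: (@le_lt_trans _ _ (K * N ^+ 2 * `|delta i|)); last first.
  by rewrite mulrC -ltr_pdivlMr//; near: i; exact: delta_lt.
(* Where [eta] vanishes, the quotient is [0] by the convention for the inverse of zero. *)
have [->|eta_neq0] := eqVneq (eta i x) 0.
  by rewrite expr0n invr0 mulr0 normr0 mulr_ge0// ltW.
have eta2_gt0 : 0 < `|eta i x| ^+ 2 by rewrite exprn_gt0// normr_gt0.
rewrite normrM normfV normrX ler_pdivrMr//.
apply: (@le_trans _ _ (K * `|delta i ^+ 3|)); first by near: i.
rewrite normrX (_ : K * _ = K * `|delta i| * `|delta i| ^+ 2); last by ring.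
rewrite [leRHS](_ : _ = K * `|delta i| * (N * `|eta i x|) ^+ 2); last by ring.
rewrite ler_wpM2l ?mulr_ge0 ?(ltW K_gt0)//.
rewrite ler_pXn2r// ?nnegrE// ?mulr_ge0// ?(ltW N_gt0)//.
by near: i.
Unshelve. all: by end_near. Qed.
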